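(* Let $E$ and $B$ be finite $T_0$-spaces with $E\neq\varnothing$ and let $p\colon E\to B$ be a Hurewicz fibration. Let $e\in E$ and let $b\in F_{p(e)}$. Then there exists $e'\in U_e\cap p^{-1}(p(e))$ such that $F_{e'}\cap p^{-1}(b)\neq\varnothing$.
   Context: A finite $T_0$-space $X$ is regarded as a poset: $U_a$ denotes the smallest open subset of $X$ containing $a$, and $x\leq y$ if and only if $U_x\subseteq U_y$, so that $U_a=\{x\in X: x\leq a\}$. Also $F_a=\overline{\{a\}}=\{x\in X: x\geq a\}$. A Hurewicz fibration is a continuous map with the homotopy lifting property with respect to all topological spaces. *)

(* Defs.v *)
From HB Require Import structures.
From mathcomp Require Import all_boot all_order all_algebra.
From mathcomp Require Import all_classical all_reals.
From mathcomp Require Import topology normedtype.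
Set Implicit Arguments.
Unset Strict Implicit.
Unset Printing Implicit Defensive.
Import Order.TTheory GRing.Theory Num.Theory.
Import numFieldNormedType.Exports.
Local Open Scope classical_set_scope.
Local Open Scope ring_scope.

Definition finite_T0_space (X : topologicalType) : Prop :=
  finite_set [set: X] /\ kolmogorov_space X.

(* U_a; in a finite space it is the smallest open set containing a, see
   [minimal_open_is_open] and [minimal_open_sub]. *)
Definition minimal_open (X : topologicalType) (a : X) : set X :=
  \bigcap_(V in [set V : set X | open V /\ V a]) V.

(* F_a *)
Definition point_closure (X : topologicalType) (a : X) : set X :=
  closure [set a].

(* The closed unit interval as a topological space of its own: the subtype of R
   with the initial topology for the inclusion. *)
Definition unit_interval (R : realType) : topologicalType :=
  set_type (`[0, 1]%classic : set R).

Lemma unit_interval0_subproof (R : realType) : (0 : R) \in `[0, 1]%classic.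
Proof. by rewrite inE /= in_itv /= lexx ler01. Qed.

Definition unit_interval0 (R : realType) : unit_interval R :=
  SigSub (unit_interval0_subproof R).

Definition homotopy_lifting_property (R : realType) (E B X : topologicalType)
    (p : E -> B) : Prop :=
  forall (f : X -> E) (H : X * unit_interval R -> B),
    continuous f -> continuous H ->
    (forall x, H (x, unit_interval0 R) = p (f x)) ->
  exists H' : X * unit_interval R -> E,
    [/\ continuous H',
        forall x, H' (x, unit_interval0 R) = f x
      & forall z, p (H' z) = H z].

Definition hurewicz_fibration (R : realType) (E B : topologicalType)
    (p : E -> B) : Prop :=
  continuous p /\
  forall X : topologicalType, homotopy_lifting_property R X p.

Lemma minimal_open_is_open (X : topologicalType) (a : X) :
  finite_set [set: X] -> open (minimal_open a).
Proof.
move=> finX.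
have /choice[W HW] (y : X) : exists V : set X,
    [/\ open V, V a & ~ minimal_open a y -> ~ V y].
  have [Uay|/existsNP[V /not_implyP[[oV Va] nVy]]] := pselect (minimal_open a y).
    by exists setT; split=> //; exact: openT.
  by exists V.
rewrite openE => x Uax; rewrite /interior.
have [D DT] := (finite_fsetP).1 finX.
apply: filterS (@filter_bigI _ _ D W (nbhs x) _ _) => [y Wy|y _].
  apply: contrapT => nUay; have [_ _ /(_ nUay)] := HW y; apply.
  by apply: Wy; rewrite -DT.
have [oW Wa _] := HW y.
by apply: open_nbhs_nbhs; split=> //; apply: Uax.
Qed.

Lemma minimal_open_sub (X : topologicalType) (a : X) (V : set X) :
  open V -> V a -> minimal_open a a /\ minimal_open a `<=` V.
Proof. by move=> oV Va; split => [W [] //|x]; apply; split. Qed.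

Lemma mem_minimal_open (X : topologicalType) (a x : X) :
  minimal_open a x <-> minimal_open x `<=` minimal_open a.
Proof.
split=> [Uax y Uxy V [oV Va]|]; first by apply: Uxy; split=> //; apply: Uax.
by apply=> V [].
Qed.

Lemma mem_point_closure (X : topologicalType) (a x : X) :
  point_closure a x <-> minimal_open a `<=` minimal_open x.
Proof.
rewrite -mem_minimal_open; split=> [Fax V [oV Vx]|Uxa A].
  by have [_ [-> Va]] := Fax _ (open_nbhs_nbhs (conj oV Vx)).
by rewrite nbhsE => -[V [oV Vx] VA]; exists a; split=> //; apply: VA; apply: Uxa.
Qed.

(* Main.v *)
(** Lift, over the space [I] with the particular point topology at [0], the
    homotopy that starts at [e] everywhere, stays at [p e] over the
    particular point, and over every [s <> 0] jumps to [b] at time [s] only.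
    The lifted path over [0] stays in [U_e] for short times and, since [0] lies
    in every neighbourhood of [s], at time [s] it is below the path over [s],
    which then lies over [b]. *)
Require Import Defs.
From HB Require Import structures.
From mathcomp Require Import all_boot all_order all_algebra.
From mathcomp Require Import all_classical all_reals.
From mathcomp Require Import topology normedtype.
Import Order.TTheory GRing.Theory Num.Theory.
Import numFieldNormedType.Exports.
Local Open Scope classical_set_scope.

(** An alias indexed by the point, so that a topology depending on [x0] can be attached without
    clashing with the one that [T] may already carry. *)
Definition particular_point (T : choiceType) (x0 : T) : Type := T.

Section ParticularPoint.
Variables (T : choiceType) (x0 : T).

HB.instance Definition _ := Choice.on (particular_point T x0).

Let pp_open (A : set (particular_point T x0)) := A !=set0 -> A x0.

Let pp_openT : pp_open setT. Proof. by []. Qed.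

Let pp_openI A B : pp_open A -> pp_open B -> pp_open (A `&` B).
Proof. by move=> oA oB [x [Ax Bx]]; split; [apply: oA|apply: oB]; exists x. Qed.

Let pp_open_bigU (I : Type) (F : I -> set (particular_point T x0)) :
  (forall i, pp_open (F i)) -> pp_open (\bigcup_i F i).
Proof. by move=> oF [x [i _ Fx]]; exists i => //; apply: oF; exists x. Qed.

HB.instance Definition _ := isOpenTopological.Build (particular_point T x0)
  pp_openT pp_openI pp_open_bigU.

(** The set {x, x0} is open and lies in every neighbourhood of [x]. *)
Lemma particular_point_nbhsE (x : particular_point T x0)
    (A : set (particular_point T x0)) :
  nbhs x A <-> A x /\ A x0.
Proof.
split=> [|[Ax Ax0]].
  by rewrite nbhsE => -[V [oV Vx] VA]; split; apply: VA => //; apply: oV; exists x.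
by apply: open_nbhs_nbhs; split.
Qed.

End ParticularPoint.

Section UnitInterval.
Variable R : realType.
Local Open Scope ring_scope.

Lemma unit_interval_open_neq (s : unit_interval R) :
  open [set t : unit_interval R | t != s].
Proof.
rewrite (_ : [set t | _] = (\val : unit_interval R -> R) @^-1` [set x | x != \val s]).
  by apply: open_comp; [move=> *; apply: initial_continuous|apply: open_neq].
by apply/seteqP; split=> t /=; rewrite (inj_eq val_inj).
Qed.

Lemma nbhs_unit_interval0_neq (V : set (unit_interval R)) :
  nbhs (unit_interval0 R) V -> exists2 s, V s & s != unit_interval0 R.
Proof.
rewrite nbhsE => -[_ [[W oW <-] W0] WV].
have /nbhs_ballP[r /= r0 rW] : nbhs (0 : R) W by apply: open_nbhs_nbhs.
(* Halving [r] keeps the point inside the ball, and the cap 1 keeps it inside the interval. *)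
have m0 : 0 < Num.min (r / 2) 1 by rewrite lt_min ltr01 divr_gt0.
have mI : Num.min (r / 2) 1 \in (`[0, 1]%classic : set R).
  by rewrite inE /= in_itv /= (ltW m0) ge_min lexx orbT.
exists (SigSub mI : unit_interval R); last first.
  by rewrite -(inj_eq val_inj) /= gt_eqF.
apply: WV; apply: rW; rewrite /ball /= sub0r normrN gtr0_norm //.
by rewrite gt_min ltr_pdivrMr // mulr_natr mulr2n ltrDl r0.
Qed.

End UnitInterval.

Theorem theorem5p15 (R : realType) (E B : topologicalType)
    (finT0E : finite_T0_space E) (finT0B : finite_T0_space B)
    (E_neq0 : [set: E] !=set0)
    (p : E -> B) (fib_p : hurewicz_fibration R p)
    (e : E) (b : B) (Fpe_b : b \in point_closure (p e)) :
  exists2 e' : E, e' \in minimal_open e `&` p @^-1` [set p e]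
                & point_closure e' `&` p @^-1` [set b] !=set0.
Proof.
set i0 := unit_interval0 R.
pose X : topologicalType := particular_point (unit_interval R) i0.
(* The second test removes the jump at time [i0]: thus [H] starts at [p e] everywhere and is
   constant over the particular point. *)
pose H (z : X * unit_interval R) : B :=
  if (z.2 == z.1) && (z.2 != i0) then b else p e.
have Ub W : open W -> W b -> W (p e).
  move=> oW Wb; move: Fpe_b; rewrite inE => /(_ W).
  by case=> [|_ [-> //]]; apply: open_nbhs_nbhs.
have cH : continuous H.
  move=> [s t] A; rewrite /= nbhsE => -[W [oW WH] WA].
  change (nbhs (s, t) (H @^-1` A)).
  apply: (@filterS _ _ _ (H @^-1` W)); first by move=> z /WA.
  (* If [W] contains [b], then by [Ub] its preimage is everything. Otherwise the preimage is the
     complement of the jumps (x, x) with x different from [i0]. *)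
  have [Wb|nWb] := pselect (W b).
    apply: (@filterS _ _ _ setT); last exact: filterT.
    by move=> z _; rewrite /H /=; case: ifP => // _; apply: Ub.
  have Wpe : W (p e) by move: WH; rewrite /H; case: ifP.
  have [ts|ts] := eqVneq t s.
    (* The only diagonal point that is not a jump is (i0, i0); there {i0} is open and [H] is
       constant over it. *)
    have t0 : t = i0.
      apply/eqP; apply: contrapT => /negP t0; apply: nWb.
      by move: WH; rewrite /H /= -ts eqxx t0.
    exists ([set i0 : X], setT) => /=.
      split; last exact: filterT.
      by apply/particular_point_nbhsE; rewrite -ts t0.
    by case=> x y [/= -> _]; rewrite /H /=; case: (eqVneq y i0).
  (* Over [s] the jump is avoided by excluding the time [s]; over [i0] there is no jump. *)
  exists ([set x : X | x = s \/ x = i0], [set y | y != s]) => /=.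
    split; first by apply/particular_point_nbhsE; split; [left|right].
    by apply: open_nbhs_nbhs; split=> //; apply: unit_interval_open_neq.
  case=> x y [/= [->|->] ys]; rewrite /H /=; first by rewrite (negbTE ys).
  by case: (eqVneq y i0).
have [_ /(_ X (fun=> e) H)] := fib_p.
case=> [|//|x|H' [cH' H'0 pH']]; first by move=> x; apply: cst_continuous.
  by rewrite /H /= eqxx andbF.
have oUe : open (minimal_open e) by apply: minimal_open_is_open; case: finT0E.
have : nbhs ((i0 : X), i0) (H' @^-1` minimal_open e).
  by apply: cH'; apply: open_nbhs_nbhs; split=> //; rewrite H'0 => V [].
case=> -[U V] /= [/particular_point_nbhsE [U0 _] V0] UV.
(* Since 0 is not isolated, there is a nonzero time at which the lifted path over [i0] is still in
   U_e. *)
have [s Vs s0] := nbhs_unit_interval0_neq _ _ V0.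
exists (H' ((i0 : X), s)).
  rewrite inE; split; first by apply: UV.
  by rewrite /= pH' /H /= (negbTE s0).
exists (H' ((s : X), s)); split; last by rewrite /= pH' /H /= eqxx s0.
(* Every neighbourhood [A] of H'(s, s) must contain H'(i0, s): the factor [U'] is a neighbourhood of
   [s], hence contains [i0]. *)
move=> A /cH' [[U' V'] /= [/particular_point_nbhsE [_ U'0] V's] UV'].
exists (H' ((i0 : X), s)); split=> //.
by apply: UV'; split=> //=; apply: nbhs_singleton.
Qed.
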